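(* Let $X$ be a topological space. If the Alexandroff duplicate $A(X)$ is strongly star-Menger (respectively, strongly star-Hurewicz, strongly star-Rothberger), then $X$ is also strongly star-Menger (respectively, strongly star-Hurewicz, strongly star-Rothberger).
   Context: The Alexandroff duplicate of $X$ is $A(X)=X\times\{0,1\}$, where each point of $X\times\{1\}$ is isolated and a basic neighbourhood of $\langle x,0\rangle$ is a set of the form $(U\times\{0\})\cup((U\times\{1\})\setminus\{\langle x,1\rangle\})$ with $U$ a neighbourhood of $x$ in $X$. For a subset $A$ of a space $Z$ and a collection $\mathcal{P}$ of subsets of $Z$, $St(A,\mathcal{P})=\bigcup\{B\in\mathcal{P} : A\cap B\neq\emptyset\}$, and $St(x,\mathcal{P})=St(\{x\},\mathcal{P})$. A space $Z$ is: - strongly star-Menger if for each sequence $(\mathcal{U}_n)_{n\in\mathbb{N}}$ of open covers of $Z$ there are finite sets $F_n\subseteq Z$ such that $\{St(F_n,\mathcal{U}_n) : n\in\mathbb{N}\}$ covers $Z$; - strongly star-Hurewicz if for each sequence $(\mathcal{U}_n)_{n\in\mathbb{N}}$ of open covers of $Z$ there are finite sets $F_n\subseteq Z$ such that each $z\in Z$ belongs to $St(F_n,\mathcal{U}_n)$ for all but finitely many $n$; - strongly star-Rothberger if for each sequence $(\mathcal{U}_n)_{n\in\mathbb{N}}$ of open covers of $Z$ there are points $x_n\in Z$ such that $\{St(x_n,\mathcal{U}_n) : n\in\mathbb{N}\}$ covers $Z$. *)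

(* Defs.v *)
From HB Require Import structures.
From mathcomp Require Import all_boot.
From mathcomp Require Import boolp classical_sets functions cardinality topology.

Set Implicit Arguments.
Unset Strict Implicit.
Unset Printing Implicit Defensive.

Local Open Scope classical_set_scope.

Section Star.
Context {Z : topologicalType}.

Definition open_cover (P : set (set Z)) :=
  P `<=` open /\ \bigcup_(B in P) B = [set: Z].

Definition St (A : set Z) (P : set (set Z)) : set Z :=
  \bigcup_(B in [set B | P B /\ A `&` B !=set0]) B.

End Star.

Definition strongly_star_Menger (Z : topologicalType) :=
  forall U : nat -> set (set Z), (forall n, open_cover (U n)) ->
  exists F : nat -> set Z, (forall n, finite_set (F n)) /\
    \bigcup_n St (F n) (U n) = [set: Z].

Definition strongly_star_Hurewicz (Z : topologicalType) :=
  forall U : nat -> set (set Z), (forall n, open_cover (U n)) ->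
  exists F : nat -> set Z, (forall n, finite_set (F n)) /\
    forall z, finite_set [set n | ~ St (F n) (U n) z].

Definition strongly_star_Rothberger (Z : topologicalType) :=
  forall U : nat -> set (set Z), (forall n, open_cover (U n)) ->
  exists x : nat -> Z, \bigcup_n St [set x n] (U n) = [set: Z].

(* An alias, so that the canonical product topology on [X * bool] does not
   apply; the copies [X * {0}] and [X * {1}] are tagged [false] and [true]. *)
Definition alexandroff_duplicate (X : Type) : Type := (X * bool)%type.

Section AlexandroffDuplicate.
Context {X : topologicalType}.
Local Notation AX := (alexandroff_duplicate X).

Definition duplicate_basic_nbhs (x : X) (U : set X) : set AX :=
  (U `*` [set false]) `|` ((U `*` [set true]) `\ (x, true)).

(* A set is open when it contains a basic neighbourhood of each of its points,
   the basic neighbourhood of a point [(x, true)] being its singleton.  If [X]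
   is not T1 the basic neighbourhoods of [(x, false)] need not satisfy the
   neighbourhood axioms, but this is a topology for every [X]; see
   [duplicate_nbhs_false] for the T1 case. *)
Definition duplicate_open (A : set AX) :=
  forall x, A (x, false) ->
    exists2 U, nbhs x U & duplicate_basic_nbhs x U `<=` A.

Let duplicate_openT : duplicate_open [set: AX].
Proof. by move=> x _; exists setT => //; exact: filterT. Qed.

Let duplicate_openI : setI_closed duplicate_open.
Proof.
move=> A B oA oB x [/oA[U xU UA] /oB[V xV VB]].
exists (U `&` V); first exact: filterI.
move=> p [[[? ?] ?]|[[[? ?] ?] ?]]; split.
- by apply: UA; left.
- by apply: VB; left.
- by apply: UA; right.
- by apply: VB; right.
Qed.

Let duplicate_open_bigU (I : Type) (f : I -> set AX) :
  (forall i, duplicate_open (f i)) -> duplicate_open (\bigcup_i f i).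
Proof.
move=> of_ x [i _ /of_[U xU Uf]]; exists U => // p /Uf fp.
by exists i.
Qed.

HB.instance Definition _ := Choice.on AX.
HB.instance Definition _ := isOpenTopological.Build AX
  duplicate_openT duplicate_openI duplicate_open_bigU.

Lemma open_duplicateE (A : set AX) : open A = duplicate_open A.
Proof. by []. Qed.

Lemma duplicate_nbhs_true (x : X) (A : set AX) :
  nbhs ((x, true) : AX) A <-> A (x, true).
Proof.
split=> [/nbhs_singleton//|Ax].
rewrite nbhsE; exists [set (x, true)]; last by move=> _ ->.
by split=> // y.
Qed.

Lemma duplicate_nbhs_false (x : X) (A : set AX) : accessible_space X ->
  nbhs ((x, false) : AX) A <->
  exists2 U, nbhs x U & duplicate_basic_nbhs x U `<=` A.
Proof.
move=> T1X; split.
  rewrite (@nbhsE AX) => -[B [oB Bx] BA]; have [U xU UB] := oB x Bx.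
  by exists U => //; exact: subset_trans UB BA.
move=> [U]; rewrite nbhsE => -[V [oV Vx] VU] UA.
rewrite nbhsE; exists (duplicate_basic_nbhs x V); last first.
  move=> [y b] yb; apply: UA; move: yb.
  by move=> [[/= /VU ? ?]|[[/= /VU ? ?] ?]]; [left|right].
split; last by left.
move=> y [[/= Vy _]|[[_ /= byf] _]]; last by [].
have [->|/eqP yx] := pselect (y = x).
  by exists V => //; exact: open_nbhs_nbhs.
have [W [oW /set_mem Wy /set_mem Wx]] := T1X y x yx.
exists (V `&` W).
  by apply: open_nbhs_nbhs; split; [exact: openI|].
move=> [z b] [[[/= Vz Wz] bE]|[[[/= Vz Wz] bE] _]]; first by left.
by right; split=> // -[zx _]; apply: Wx; rewrite -zx.
Qed.

End AlexandroffDuplicate.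

(* Main.v *)
Require Import Defs.
From mathcomp Require Import all_boot.
From mathcomp Require Import boolp classical_sets functions cardinality topology.

(** All three properties pass to continuous surjective images: pull the covers
    back, take the finite sets upstairs and push them forward.  The projection
    of the duplicate onto [X] is such a map. *)

Local Open Scope classical_set_scope.

Section ContinuousImage.
Context {Y Z : topologicalType} (f : Y -> Z).

(** [A] meets [f @^-1] B[exactly when]f @[A] meets [B], so taking stars commutes with pulling back.
    This turns a star containing [y] upstairs into one containing [f y] downstairs. *)
Lemma St_preimage (A : set Y) (P : set (set Z)) :
  St A (preimage f @` P) = f @^-1` St (f @` A) P.
Proof.
apply/seteqP; split=> y.
  move=> [_ [[B PB <-] [a [Aa Ba]]] By]; exists B => //.
  by split=> //; exists (f a); split=> //; exists a.
move=> [B [PB [_ [[a Aa <-] Ba]]] By]; exists (f @^-1` B) => //.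
by split; [exists B|exists a].
Qed.

Hypotheses (f_cont : continuous f) (f_surj : forall z, exists y, f y = z).

Lemma open_cover_preimage (P : set (set Z)) :
  open_cover P -> open_cover (preimage f @` P).
Proof.
move=> [oP cP]; split.
  by move=> _ [B /oP oB <-]; apply: open_comp => // y _; exact: f_cont.
apply/seteqP; split=> // y _.
have [B PB By] : (\bigcup_(B in P) B) (f y) by rewrite cP.
by exists (f @^-1` B) => //; exists B.
Qed.

Lemma strongly_star_Menger_image :
  strongly_star_Menger Y -> strongly_star_Menger Z.
Proof.
move=> MY U oU.
have [F [finF cF]] := MY _ (fun n => open_cover_preimage (U n) (oU n)).
exists (fun n => f @` F n); split=> [n|]; first exact: finite_image.
apply/seteqP; split=> // z _; have [y <-] := f_surj z.
have [n _ Sy] : (\bigcup_n St (F n) (preimage f @` U n)) y by rewrite cF.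
by exists n => //; move: Sy; rewrite St_preimage.
Qed.

Lemma strongly_star_Hurewicz_image :
  strongly_star_Hurewicz Y -> strongly_star_Hurewicz Z.
Proof.
move=> HY U oU.
have [F [finF cF]] := HY _ (fun n => open_cover_preimage (U n) (oU n)).
exists (fun n => f @` F n); split=> [n|z]; first exact: finite_image.
have [y <-] := f_surj z.
(* The indices that fail at [f y] downstairs are those that fail at [y] upstairs. *)
by apply: sub_finite_set (cF y) => n /=; rewrite St_preimage.
Qed.

Lemma strongly_star_Rothberger_image :
  strongly_star_Rothberger Y -> strongly_star_Rothberger Z.
Proof.
move=> RY U oU.
have [x cx] := RY _ (fun n => open_cover_preimage (U n) (oU n)).
exists (f \o x); apply/seteqP; split=> // z _; have [y <-] := f_surj z.
have [n _ Sy] : (\bigcup_n St [set x n] (preimage f @` U n)) y by rewrite cx.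
(* The image of a singleton is a singleton, so there is still one point per cover. *)
by exists n => //; move: Sy; rewrite St_preimage image_set1.
Qed.

End ContinuousImage.

(** Typed on the alias, so that the domain carries the duplicate topology and not the product
    one. *)
Definition duplicate_proj {X : Type} (p : alexandroff_duplicate X) : X := p.1.

(** The preimage of an open [B] is both copies of [B]. Openness is tested only at points
    [(x, false)], and there [B] itself serves as the neighbourhood of [x]. *)
Lemma duplicate_proj_continuous (X : topologicalType) :
  continuous (@duplicate_proj X).
Proof.
apply/continuousP => B oB; rewrite open_duplicateE => x Bx.
exists B; first exact: open_nbhs_nbhs.
by move=> p [[]|[[]]].
Qed.

Lemma duplicate_proj_surjective (X : Type) (x : X) :
  exists p, duplicate_proj p = x.
Proof. by exists (x, false). Qed.

Theorem theorem3p24 (X : topologicalType) :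
  (strongly_star_Menger (alexandroff_duplicate X) ->
     strongly_star_Menger X) /\
  (strongly_star_Hurewicz (alexandroff_duplicate X) ->
     strongly_star_Hurewicz X) /\
  (strongly_star_Rothberger (alexandroff_duplicate X) ->
     strongly_star_Rothberger X).
Proof.
have pc := duplicate_proj_continuous X.
have ps := duplicate_proj_surjective X.
split; last split.
- exact: strongly_star_Menger_image pc ps.
- exact: strongly_star_Hurewicz_image pc ps.
- exact: strongly_star_Rothberger_image pc ps.
Qed.
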